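(* Let $G$ be a cell complex given by a subset of the quadrilaterals of the $\mathbb{Z}^2$ lattice, with $G$ and its dual $G^*$ simply connected. Consider an orthogonal ring pattern $\mathcal{R}$ on $G$ whose rings have area $\pi$, with $\rho$-radii $\rho_i$, $v_i\in V(G)$. Then the $\rho$-radii $\rho_i^\delta=\rho_i+\delta$, $\delta\in\mathbb{R}$, define a one-parameter family of orthogonal ring patterns $\mathcal{R}^\delta$ on $G$ with inner and outer radii $$r_i^\delta=\sinh(\rho_i+\delta),\qquad R_i^\delta=\cosh(\rho_i+\delta),$$ and with ring area $A^\delta=\pi$.
   Context: **Complex.** $G$ is a cell complex defined by a subset of the quadrilaterals (unit squares) of the $\mathbb{Z}^2$ lattice in $\mathbb{R}^2$, with vertices $v_{m,n}$, $(m,n)\in\mathbb{Z}^2$, and horizontal edges $(v_{m,n},v_{m+1,n})$ and vertical edges $(v_{m,n},v_{m,n+1})$. Inner vertices have four neighbors; vertices with fewer neighbors are boundary vertices. The dual complex $G^*$ has the 2-cells of $G$ as vertices, and its edges correspond to the edges of $G$ shared by two neighboring 2-cells. **Rings.** A ring is a pair of concentric circles in $\mathbb{R}^2$: an inner circle $c$ of signed radius $r\in\mathbb{R}$ and an outer circle $C$ of radius $R>0$, the area being $\pi(R^2-r^2)$. $r>0$ corresponds to counter-clockwise and $r<0$ to clockwise orientation; if $r=0$ the inner circle degenerates to its center, and orthogonal intersection of $C'$ with $c$ means that $C'$ passes through that point. **Orthogonal ring pattern on $G$.** An assignment of rings to the vertices of $G$ (centers identified with vertices) such that: (i) rings at neighboring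 vertices $v_i,v_j$ intersect orthogonally, i.e. $C_i$ intersects $c_j$ orthogonally and $C_j$ intersects $c_i$ orthogonally; (ii) in each square of $G$ the inner circles $c_{m,n}$, $c_{m+1,n+1}$ and the outer circles $C_{m,n+1}$, $C_{m+1,n}$ pass through one point (then the two inner circles touch and the two outer circles touch at this point); (iii) for any ring $(C_{m,n},c_{m,n})$ the four touching points $C_{m,n}\cap C_{m+1,n-1}$, $c_{m,n}\cap c_{m+1,n+1}$, $C_{m,n}\cap C_{m-1,n+1}$, $c_{m,n}\cap c_{m-1,n-1}$ are in counter-clockwise order if $r_{m,n}>0$ and in clockwise order if $r_{m,n}<0$. **$\rho$-radii.** All rings of an orthogonal ring pattern have the same area $\pi\ell_0^2$, so $R_i^2-r_i^2=\ell_0^2$; the $\rho$-radius $\rho_i\in\mathbb{R}$ is defined by $R_i=\ell_0\cosh\rho_i$, $r_i=\ell_0\sinh\rho_i$ (here $\ell_0=1$).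
   Formalization: In a ring pattern the outer circles of each square are required to touch externally, and the orientation condition (iii) is imposed on consecutive touching points at boundary vertices too; otherwise folded patterns (e.g. on a 2×2 block) violate the claim. *)

(* Defs.v *)
From Stdlib Require Import Reals ZArith List.
From Coquelicot Require Import Coquelicot.
Import ListNotations.
Open Scope R_scope.

(** * Simple connectivity of a complex with quadrilateral 2-cells

    A complex on [T] is given by its vertex set, its (symmetric) adjacency and
    its 2-cells; [face a b c d] means that the closed edge path a, b, c, d, a
    bounds a 2-cell.  Simple connectivity is expressed by edge paths: the group
    of edge loops modulo the homotopies below is the fundamental group. *)

Fixpoint is_walk {T : Type} (adj : T -> T -> Prop) (x : T) (l : list T) (y : T)
  : Prop :=
  match l with
  | [] => x = y
  | z :: l' => adj x z /\ is_walk adj z l' y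
  end.

(** One starting corner and one direction per 2-cell suffice in [homotopic_face]:
    the other ones follow by inserting and removing backtrackings. *)
Inductive homotopic {T : Type} (adj : T -> T -> Prop)
    (face : T -> T -> T -> T -> Prop) : list T -> list T -> Prop :=
| homotopic_refl l : homotopic adj face l l
| homotopic_sym l1 l2 : homotopic adj face l1 l2 -> homotopic adj face l2 l1
| homotopic_trans l1 l2 l3 :
    homotopic adj face l1 l2 -> homotopic adj face l2 l3 ->
    homotopic adj face l1 l3
| homotopic_backtrack l1 l2 x y : adj x y ->
    homotopic adj face (l1 ++ [x; y; x] ++ l2) (l1 ++ [x] ++ l2)
| homotopic_face l1 l2 a b c d : face a b c d ->
    homotopic adj face (l1 ++ [a; b; c; d; a] ++ l2) (l1 ++ [a] ++ l2).

Definition simply_connected {T : Type} (vert : T -> Prop)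
    (adj : T -> T -> Prop) (face : T -> T -> T -> T -> Prop) : Prop :=
  (forall x y, vert x -> vert y -> exists l, is_walk adj x l y) /\
  (forall x l, vert x -> is_walk adj x l x -> homotopic adj face (x :: l) [x]).

(** * Subcomplexes of the square lattice and their duals

    [G (m, n)] means that the unit square with corners [(m, n)], [(m+1, n)],
    [(m+1, n+1)], [(m, n+1)] is a 2-cell; the vertices and edges of the complex
    are those of its 2-cells. *)

Definition quad_complex := Z * Z -> Prop.

Definition is_vertex (G : quad_complex) (v : Z * Z) : Prop :=
  let (m, n) := v in
  (G (m, n) \/ G (m - 1, n) \/ G (m - 1, n - 1) \/ G (m, n - 1))%Z.

Inductive neighbor (G : quad_complex) : Z * Z -> Z * Z -> Prop :=
| neighbor_h m n : G (m, n) \/ G (m, n - 1)%Z ->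
    neighbor G (m, n) (m + 1, n)%Z
| neighbor_v m n : G (m, n) \/ G (m - 1, n)%Z ->
    neighbor G (m, n) (m, n + 1)%Z
| neighbor_sym v w : neighbor G v w -> neighbor G w v.

Inductive square_face (G : quad_complex)
  : Z * Z -> Z * Z -> Z * Z -> Z * Z -> Prop :=
| square_face_intro m n : G (m, n) ->
    square_face G (m, n) (m + 1, n)%Z (m + 1, n + 1)%Z (m, n + 1)%Z.

Definition complex_simply_connected (G : quad_complex) : Prop :=
  simply_connected (is_vertex G) (neighbor G) (square_face G).

Inductive dual_neighbor (G : quad_complex) : Z * Z -> Z * Z -> Prop :=
| dual_neighbor_h m n : G (m, n) -> G (m + 1, n)%Z ->
    dual_neighbor G (m, n) (m + 1, n)%Z
| dual_neighbor_v m n : G (m, n) -> G (m, n + 1)%Z ->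
    dual_neighbor G (m, n) (m, n + 1)%Z
| dual_neighbor_sym s t : dual_neighbor G s t -> dual_neighbor G t s.

(** The 2-cells of the dual complex are dual to the vertices [(m, n)] all of
    whose four surrounding squares belong to [G]. *)
Inductive dual_face (G : quad_complex)
  : Z * Z -> Z * Z -> Z * Z -> Z * Z -> Prop :=
| dual_face_intro m n :
    G (m - 1, n - 1)%Z -> G (m, n - 1)%Z -> G (m, n) -> G (m - 1, n)%Z ->
    dual_face G (m - 1, n - 1)%Z (m, n - 1)%Z (m, n) (m - 1, n)%Z.

Definition dual_simply_connected (G : quad_complex) : Prop :=
  simply_connected G (dual_neighbor G) (dual_face G).

(** * Circles and rings in the plane, identified with [C] *)

Definition dot (z w : C) : R := fst z * fst w + snd z * snd w.
Definition det (z w : C) : R := fst z * snd w - snd z * fst w.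

(** Circles have signed radii; a circle of radius 0 is its center. *)
Definition on_circle (a : C) (r : R) (p : C) : Prop := Cmod (p - a) = Rabs r.

(** If [r = 0] this says that the circle [(b, s)] passes through [a]. *)
Definition circles_orthogonal (a : C) (r : R) (b : C) (s : R) : Prop :=
  (exists p, on_circle a r p /\ on_circle b s p) /\
  (forall p, on_circle a r p -> on_circle b s p -> dot (p - a) (p - b) = 0).

Definition circles_touch_at (a : C) (r : R) (b : C) (s : R) (p : C) : Prop :=
  on_circle a r p /\ on_circle b s p /\ det (p - a) (p - b) = 0.

Definition circles_touch_externally_at (a : C) (r : R) (b : C) (s : R) (p : C)
  : Prop :=
  circles_touch_at a r b s p /\ dot (p - a) (p - b) < 0.

Record planar_ring := PlanarRing {
  center : C;
  inner : R;
  outer : R;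
  inner_lt_outer : Rabs inner < outer
}.

Definition ring_area (A : planar_ring) : R := PI * (outer A ^ 2 - inner A ^ 2).

Definition rings_orthogonal (A B : planar_ring) : Prop :=
  circles_orthogonal (center A) (outer A) (center B) (inner B) /\
  circles_orthogonal (center A) (inner A) (center B) (outer B).

(** [x] is the rho-radius of a ring of area [PI * l0 ^ 2]. *)
Definition is_rho_radius (l0 : R) (A : planar_ring) (x : R) : Prop :=
  outer A = l0 * cosh x /\ inner A = l0 * sinh x.

(** * Orthogonal ring patterns *)

(** [p] is the point of the square [(m, n)] common to two inner and two outer
    circles.  The tangency of the outer circles follows from the orthogonality
    of neighboring rings except when both inner circles degenerate to points;
    outer circles always touch from outside, whereas inner circles touch from
    inside when their signed radii have opposite signs. *)
Definition touching_point (P : Z * Z -> planar_ring) (s : Z * Z) (p : C)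
  : Prop :=
  let (m, n) := s in
  let A00 := P (m, n) in
  let A10 := P (m + 1, n)%Z in
  let A11 := P (m + 1, n + 1)%Z in
  let A01 := P (m, n + 1)%Z in
  circles_touch_at (center A00) (inner A00) (center A11) (inner A11) p /\
  circles_touch_externally_at
    (center A10) (outer A10) (center A01) (outer A01) p.

(** The two squares [s], [t] follow each other in the counter-clockwise order
    around [v] in the lattice. *)
Inductive consecutive_squares : Z * Z -> Z * Z -> Z * Z -> Prop :=
| consecutive_right m n : consecutive_squares (m, n) (m, n - 1)%Z (m, n)
| consecutive_top m n : consecutive_squares (m, n) (m, n) (m - 1, n)%Z
| consecutive_left m n :
    consecutive_squares (m, n) (m - 1, n)%Z (m - 1, n - 1)%Z
| consecutive_bottom m n :
    consecutive_squares (m, n) (m - 1, n - 1)%Z (m, n - 1)%Z.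

(** The turn from [p] to [q] around the center is counter-clockwise if
    [inner A > 0] and clockwise if [inner A < 0], by an angle less than [PI]. *)
Definition turns_with_orientation (A : planar_ring) (p q : C) : Prop :=
  (0 < inner A -> 0 < det (p - center A) (q - center A)) /\
  (inner A < 0 -> det (p - center A) (q - center A) < 0).

(** [orp_order] is imposed on consecutive touching points, so that it also makes
    sense at boundary vertices, where some of the four are missing.  At a vertex
    surrounded by four squares, four turns in the same direction by angles in
    (0, PI) add up to one full turn: the four touching points are in cyclic
    order. *)
Record orthogonal_ring_pattern (G : quad_complex) (P : Z * Z -> planar_ring)
  : Prop := {
  orp_neighbors : forall v w, neighbor G v w -> rings_orthogonal (P v) (P w);
  orp_squares : forall s, G s -> exists p, touching_point P s p;
  orp_order : forall v s t p q,
    consecutive_squares v s t -> G s -> G t ->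
    touching_point P s p -> touching_point P t q ->
    turns_with_orientation (P v) p q
}.

(* Main.v *)
Require Import Defs.
From Stdlib Require Import Reals ZArith List Lra ClassicalEpsilon.
From Coquelicot Require Import Coquelicot.
Import ListNotations.
Open Scope R_scope.

(** In a square let u be the unit vector from the (0,1) to the (1,0) center.
    Around the touching point p the centers are p + R10 u, p - R01 u,
    p - r00 iu, p + r11 iu, so that a horizontal edge [(v, w)] shared by squares
    with directions u, u' gives (R_w + i r_v) u = (R_v + i r_w) u'. Here
    u / u' = (1 - i sinh (rho_v - rho_w)) / cosh (rho_v - rho_w),
    which does not change when delta is added to all rho-radii. Hence the old
    directions u together with the new radii define edge vectors that agree in
    both squares containing an edge and sum to zero around each square; since G
    is simply connected they integrate to the centers of the new pattern. *)

(** * Discrete closed 1-forms and their potentials *)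

Fixpoint path_sum {T : Type} (omega : T -> T -> C) (x : T) (l : list T) : C :=
  match l with
  | [] => 0%C
  | y :: l' => (omega x y + path_sum omega y l')%C
  end.

(** [homotopic] relates vertex lists that contain the starting vertex, while a walk keeps it apart;
    this version sums over the former. *)
Definition list_sum {T : Type} (omega : T -> T -> C) (l : list T) : C :=
  match l with
  | [] => 0%C
  | x :: l' => path_sum omega x l'
  end.

Lemma path_sum_app {T : Type} (omega : T -> T -> C) l1 x y l2 :
  path_sum omega x (l1 ++ y :: l2)
  = (path_sum omega x (l1 ++ [y]) + path_sum omega y l2)%C.
Proof.
  revert x; induction l1 as [|z l1 IH]; intros x; simpl.
  - ring.
  - rewrite IH; ring.
Qed.

Lemma list_sum_app {T : Type} (omega : T -> T -> C) l1 y l2 :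
  list_sum omega (l1 ++ y :: l2)
  = (list_sum omega (l1 ++ [y]) + path_sum omega y l2)%C.
Proof.
  destruct l1 as [|x l1]; simpl.
  - ring.
  - apply path_sum_app.
Qed.

Lemma is_walk_app {T : Type} (adj : T -> T -> Prop) x l1 y l2 z :
  is_walk adj x l1 y -> is_walk adj y l2 z -> is_walk adj x (l1 ++ l2) z.
Proof.
  revert x; induction l1 as [|t l1 IH]; intros x; simpl.
  - now intros ->.
  - intros [Hxt H1] H2; split; auto.
Qed.

Lemma path_sum_walk_app {T : Type} (adj : T -> T -> Prop) omega x l1 y l2 :
  is_walk adj x l1 y ->
  path_sum omega x (l1 ++ l2) = (path_sum omega x l1 + path_sum omega y l2)%C.
Proof.
  revert x; induction l1 as [|t l1 IH]; intros x; simpl.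
  - intros ->; ring.
  - intros [_ H1]; rewrite IH by exact H1; ring.
Qed.

Section Exactness.

Context {T : Type} (vert : T -> Prop) (adj : T -> T -> Prop)
  (face : T -> T -> T -> T -> Prop) (omega : T -> T -> C).
Hypothesis adj_vert : forall x y, adj x y -> vert x /\ vert y.
Hypothesis omega_anti : forall x y, adj x y -> omega y x = (- omega x y)%C.
Hypothesis omega_closed : forall a b c d, face a b c d ->
  (omega a b + omega b c + omega c d + omega d a = 0)%C.

(** Both elementary moves leave the sum unchanged: a backtracking cancels by antisymmetry, and the
    boundary of a 2-cell contributes zero by closedness. *)
Lemma list_sum_homotopic l1 l2 :
  homotopic adj face l1 l2 -> list_sum omega l1 = list_sum omega l2.
Proof.
  induction 1 as [l|l1 l2 _ IH|l1 l2 l3 _ IH1 _ IH2|l1 l2 x y Hxy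
                 |l1 l2 a b c d Hf].
  - reflexivity.
  - now symmetry.
  - now rewrite IH1.
  - cbn [app]; rewrite (list_sum_app omega l1 x (y :: x :: l2)),
      (list_sum_app omega l1 x l2); simpl.
    rewrite (omega_anti _ _ Hxy); ring.
  - cbn [app]; rewrite (list_sum_app omega l1 a (b :: c :: d :: a :: l2)),
      (list_sum_app omega l1 a l2); simpl.
    assert (E := omega_closed _ _ _ _ Hf).
    replace (omega a b + _)%C
      with ((omega a b + omega b c + omega c d + omega d a)
            + path_sum omega a l2)%C by ring.
    rewrite E; ring.
Qed.

(** A potential is obtained by summing along a chosen walk from a base vertex; it is consistent
    because every closed walk contracts to a point and so sums to zero. *)
Lemma closed_form_exact :
  simply_connected vert adj face ->
  exists z : T -> C, forall x y, adj x y -> (z y - z x)%C = omega x y.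
Proof.
  intros [Hconn Hloop].
  destruct (excluded_middle_informative (exists x0, vert x0)) as [[x0 H0]|Hno].
  2:{ exists (fun _ => 0%C); intros x y Hxy; destruct Hno; exists x.
      now apply (adj_vert x y). }
  set (walk_to x := epsilon (inhabits []) (fun l => is_walk adj x0 l x)).
  assert (Hwalk : forall x, vert x -> is_walk adj x0 (walk_to x) x).
  { intros x Hx; apply epsilon_spec; now apply Hconn. }
  exists (fun x => path_sum omega x0 (walk_to x)); intros x y Hxy.
  destruct (adj_vert _ _ Hxy) as [Hx Hy].
  (* One return walk [k] from [y] closes two loops at [x0], one through [x] and the edge to [y], the
     other directly through [y]. Subtracting their zero sums leaves [omega x y]. *)
  destruct (Hconn y x0 Hy H0) as [k Hk].
  assert (Hzero : forall l, is_walk adj x0 l x0 -> path_sum omega x0 l = 0%C).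
  { intros l Hl; exact (list_sum_homotopic _ _ (Hloop x0 l H0 Hl)). }
  assert (E1 : path_sum omega x0 (walk_to x ++ y :: k) = 0%C).
  { apply Hzero, is_walk_app with x; [now apply Hwalk|]. now split. }
  assert (E2 : path_sum omega x0 (walk_to y ++ k) = 0%C).
  { apply Hzero, is_walk_app with y; [now apply Hwalk|exact Hk]. }
  rewrite (path_sum_walk_app adj omega x0 _ x) in E1 by now apply Hwalk.
  rewrite (path_sum_walk_app adj omega x0 _ y) in E2 by now apply Hwalk.
  simpl in E1.
  set (A := path_sum omega x0 (walk_to x)) in *.
  set (B := path_sum omega x0 (walk_to y)) in *.
  replace (B - A)%C with ((B + path_sum omega y k)
    - (A + (omega x y + path_sum omega y k)) + omega x y)%C by ring.
  rewrite E1, E2; ring.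
Qed.

End Exactness.

(** * Orthogonal and touching circles in coordinates *)

Lemma on_circle_iff a r p :
  on_circle a r p <-> dot (p - a)%C (p - a)%C = r ^ 2.
Proof.
  unfold on_circle, Cmod, dot.
  set (d := (p - a)%C).
  assert (Hd : 0 <= fst d ^ 2 + snd d ^ 2) by nra.
  rewrite <- sqrt_Rsqr_abs; unfold Rsqr; split; intros H.
  - apply sqrt_inj in H; nra.
  - f_equal; nra.
Qed.

(** This is Pythagoras: at a common point the radii are the legs of a right triangle whose
    hypotenuse joins the centers. *)
Lemma circles_orthogonal_iff a r b s : 0 < r ^ 2 + s ^ 2 ->
  circles_orthogonal a r b s <-> dot (b - a)%C (b - a)%C = r ^ 2 + s ^ 2.
Proof.
  intros Hpos; unfold circles_orthogonal; split.
  - intros [[p [Ha Hb]] Ho]; specialize (Ho p Ha Hb).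
    rewrite on_circle_iff in Ha, Hb.
    destruct a as [a1 a2], b as [b1 b2], p as [p1 p2].
    unfold dot in *; simpl in *; nra.
  - intros H; split.
    (* The witness below is a + r (r + i s) (b - a) / (r^2 + s^2), the apex of the right triangle
       over the segment from a to b with legs r and s. *)
    + set (k := / (r ^ 2 + s ^ 2)).
      assert (Hk : k * (r ^ 2 + s ^ 2) = 1) by (unfold k; field; lra).
      exists (a + ((r * r * k)%R, (r * s * k)%R) * (b - a))%C; rewrite !on_circle_iff.
      destruct a as [a1 a2], b as [b1 b2]; unfold dot in *; cbn -[pow] in *.
      set (d1 := b1 + - a1) in *; set (d2 := b2 + - a2) in *.
      assert (E : (d1 * d1 + d2 * d2) * k = 1) by (rewrite H; cbn -[pow]; lra).
      split.
      * transitivity (r ^ 2 * ((d1 * d1 + d2 * d2) * k) * (k * (r ^ 2 + s ^ 2)));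
          [cbn -[pow]; ring|].
        rewrite E, Hk; ring.
      * replace b1 with (a1 + d1) by (unfold d1; ring).
        replace b2 with (a2 + d2) by (unfold d2; ring).
        transitivity (s ^ 2 * ((d1 * d1 + d2 * d2) * k) * (k * (r ^ 2 + s ^ 2))
          + (d1 * d1 + d2 * d2) * (1 - k * (r ^ 2 + s ^ 2))
            * (1 - k * (r ^ 2 - s ^ 2))).
        -- cbn -[pow]; ring.
        -- rewrite E, Hk; ring.
    + intros p Ha Hb; rewrite on_circle_iff in Ha, Hb.
      destruct a as [a1 a2], b as [b1 b2], p as [p1 p2].
      unfold dot in *; simpl in *; nra.
Qed.

Lemma circles_orthogonal_sym a r b s :
  circles_orthogonal a r b s -> circles_orthogonal b s a r.
Proof.
  intros [[p [Ha Hb]] Ho]; split; [now exists p|].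
  intros q Hqb Hqa; rewrite <- (Ho q Hqa Hqb); unfold dot; ring.
Qed.

Lemma rings_orthogonal_sym A B : rings_orthogonal A B -> rings_orthogonal B A.
Proof.
  intros [H1 H2]; split; now apply circles_orthogonal_sym.
Qed.

(** The unit vector from [b] to [a] when the circles touch externally. *)
Definition direction (a : C) (r : R) (b : C) (s : R) : C :=
  ((a - b) / RtoC (r + s))%C.

(** With x = p - a and y = p - b, the vanishing determinant gives (x . y)^2 = (r s)^2, and the
    negative sign selects x . y = - r s. Hence |s x + r y|^2 = 0, so x / r and y / s are opposite
    unit vectors. *)
Lemma external_touching_point a r b s p : 0 < r -> 0 < s ->
  circles_touch_externally_at a r b s p ->
  dot (direction a r b s) (direction a r b s) = 1 /\
  a = (p + r * direction a r b s)%C /\ b = (p - s * direction a r b s)%C.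
Proof.
  intros Hr Hs [[Ha [Hb Hdet]] Hdot].
  rewrite on_circle_iff in Ha, Hb.
  set (x := (p - a)%C) in *; set (y := (p - b)%C) in *.
  assert (Ea : a = (p - x)%C) by (unfold x; ring).
  assert (Eb : b = (p - y)%C) by (unfold y; ring).
  clearbody x y; subst a b.
  destruct x as [x1 x2], y as [y1 y2], p as [p1 p2].
  unfold dot, det in *; cbn [fst snd] in *.
  assert (Hsq : (x1 * y1 + x2 * y2) ^ 2 = (r * s) ^ 2).
  { replace ((r * s) ^ 2) with (r ^ 2 * s ^ 2) by ring.
    rewrite <- Ha, <- Hb.
    transitivity ((x1 * x1 + x2 * x2) * (y1 * y1 + y2 * y2)
      - (x1 * y2 - x2 * y1) ^ 2); [ring|rewrite Hdet; ring]. }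
  assert (Hd : x1 * y1 + x2 * y2 = - (r * s)).
  { assert (0 < r * s) by nra. nra. }
  assert (Hz : (s * x1 + r * y1) ^ 2 + (s * x2 + r * y2) ^ 2 = 0).
  { transitivity (s ^ 2 * (x1 * x1 + x2 * x2) + r ^ 2 * (y1 * y1 + y2 * y2)
      + 2 * r * s * (x1 * y1 + x2 * y2)); [ring|].
    rewrite Ha, Hb, Hd; ring. }
  rewrite <- !Rsqr_pow2 in Hz; destruct (Rplus_sqr_eq_0 _ _ Hz) as [H1 H2].
  assert (E : direction ((p1, p2) - (x1, x2))%C r ((p1, p2) - (y1, y2))%C s
    = ((- (x1 / r))%R, (- (x2 / r))%R)).
  { replace y1 with (- (s * x1 / r)) by (field_simplify_eq; lra).
    replace y2 with (- (s * x2 / r)) by (field_simplify_eq; lra).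
    unfold direction.
    transitivity (RtoC (r + s) * ((- (x1 / r))%R, (- (x2 / r))%R)
                  / RtoC (r + s))%C.
    - f_equal; apply injective_projections; simpl; field; lra.
    - field; intros H; apply RtoC_inj in H; lra. }
  rewrite E; cbn [fst snd]; repeat split.
  - transitivity ((x1 * x1 + x2 * x2) / r ^ 2); [field; lra|].
    rewrite Ha; field; lra.
  - apply injective_projections; simpl; field; lra.
  - replace y1 with (- (s * x1 / r)) by (field_simplify_eq; lra).
    replace y2 with (- (s * x2 / r)) by (field_simplify_eq; lra).
    apply injective_projections; simpl; field; lra.
Qed.

(** Orthogonality at [p] makes the radius of the inner circle perpendicular to [u], so the center of
    [B] lies on the line through [p] in direction i u. The sign of the offset remains open. *)
Lemma inner_offset A B p (u : C) : rings_orthogonal A B ->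
  on_circle (center A) (outer A) p -> on_circle (center B) (inner B) p ->
  dot u u = 1 -> center A = (p + outer A * u)%C ->
  exists beta : R, center B = (p - beta * (Ci * u))%C /\ beta ^ 2 = inner B ^ 2.
Proof.
  intros [[_ Ho] _] HA HB Hu HE.
  specialize (Ho p HA HB); rewrite on_circle_iff in HB.
  pose proof (inner_lt_outer A) as Hlt; pose proof (Rabs_pos (inner A)).
  (* This determinant is the component of [p - center B] along i u. *)
  exists (det u (p - center B)%C).
  destruct (center A) as [a1 a2], (center B) as [b1 b2], p as [p1 p2],
    u as [u1 u2].
  unfold dot, det in *; simpl in *.
  set (y1 := p1 + - b1) in *; set (y2 := p2 + - b2) in *.
  assert (Hd : u1 * y1 + u2 * y2 = 0).
  { assert (Hm : outer A * (u1 * y1 + u2 * y2) = 0).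
    { injection HE as E1 E2; subst a1 a2; lra. }
    apply Rmult_integral in Hm; destruct Hm; [lra|assumption]. }
  split.
  - apply injective_projections; simpl.
    + transitivity (p1 - (y1 * (u1 * u1 + u2 * u2) - u1 * (u1 * y1 + u2 * y2)));
        [rewrite Hu, Hd; unfold y1; ring|ring].
    + transitivity (p2 - (y2 * (u1 * u1 + u2 * u2) - u2 * (u1 * y1 + u2 * y2)));
        [rewrite Hu, Hd; unfold y2; ring|ring].
  - transitivity ((u1 * u1 + u2 * u2) * (y1 * y1 + y2 * y2)
      - (u1 * y1 + u2 * y2) ^ 2); [ring|].
    rewrite Hu, Hd, HB; ring.
Qed.

(** Orthogonality determines the offsets [b], [b'] only up to sign; the turning
    direction of the touching points around both ends of the edge fixes them. *)
Lemma edge_offsets (eps Rv rv Rw rw b b' : R) (u w : C) :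
  eps ^ 2 = 1 -> Rabs rv < Rv -> Rabs rw < Rw ->
  b ^ 2 = rv ^ 2 -> b' ^ 2 = rw ^ 2 -> dot w w = 1 ->
  (((eps * Rw)%R, b) * u)%C = (((eps * Rv)%R, b') * w)%C ->
  (0 < rv -> 0 < Rv * b * dot u w) -> (rv < 0 -> Rv * b * dot u w < 0) ->
  (0 < rw -> 0 < Rw * b' * dot u w) -> (rw < 0 -> Rw * b' * dot u w < 0) ->
  b = rv /\ b' = rw /\ 0 < dot u w.
Proof.
  intros Heps Hv Hw Hb Hb' Hu E Hv1 Hv2 Hw1 Hw2.
  assert (HRv : 0 < Rv) by (pose proof (Rabs_pos rv); lra).
  assert (HRw : 0 < Rw) by (pose proof (Rabs_pos rw); lra).
  (* Both sides of [E] are paired with (eps Rw + i b) w. Since |b b'| < Rv Rw, the resulting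
     identity forces [dot u w] to be positive, and the turning conditions then give the signs of [b]
     and [b']. *)
  assert (HE : (Rw ^ 2 + b ^ 2) * dot u w = Rv * Rw + b * b').
  { transitivity (dot (((eps * Rw)%R, b) * u)%C (((eps * Rw)%R, b) * w)%C).
    - transitivity ((eps ^ 2 * Rw ^ 2 + b ^ 2) * dot u w).
      + rewrite Heps; ring.
      + unfold dot; simpl; ring.
    - rewrite E; transitivity ((eps ^ 2 * (Rv * Rw) + b * b') * dot w w).
      + unfold dot; simpl; ring.
      + rewrite Heps, Hu; ring. }
  assert (Hlt : Rabs (b * b') < Rv * Rw).
  { rewrite Rabs_mult.
    assert (Rabs b = Rabs rv) by (apply Rsqr_eq_abs_0; unfold Rsqr; nra).
    assert (Rabs b' = Rabs rw) by (apply Rsqr_eq_abs_0; unfold Rsqr; nra).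
    rewrite H, H0; apply Rmult_le_0_lt_compat; auto using Rabs_pos. }
  apply Rabs_def2 in Hlt.
  assert (Hd : 0 < dot u w) by nra.
  assert (Hsign : forall R0 c r, 0 < R0 -> c ^ 2 = r ^ 2 ->
    (0 < r -> 0 < R0 * c * dot u w) -> (r < 0 -> R0 * c * dot u w < 0) -> c = r).
  { intros R0 c r HR0 Hc Hp Hn.
    assert (HP : 0 < R0 * dot u w) by (apply Rmult_lt_0_compat; assumption).
    destruct (Rtotal_order r 0) as [Hr|[Hr|Hr]].
    - specialize (Hn Hr). assert (c < 0) by nra. nra.
    - subst r; nra.
    - specialize (Hp Hr). assert (0 < c) by nra. nra. }
  repeat split; [apply (Hsign Rv)|apply (Hsign Rw)|]; assumption.
Qed.

(** * Hyperbolic identities and the shift of an edge vector *)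

Lemma cosh2_sinh2 x : cosh x ^ 2 = 1 + sinh x ^ 2.
Proof.
  unfold cosh, sinh; rewrite exp_Ropp; field; apply Rgt_not_eq, exp_pos.
Qed.

Lemma cosh_plus x y : cosh (x + y) = cosh x * cosh y + sinh x * sinh y.
Proof.
  unfold cosh, sinh; rewrite Ropp_plus_distr, !exp_plus; field.
Qed.

Lemma sinh_plus x y : sinh (x + y) = sinh x * cosh y + cosh x * sinh y.
Proof.
  unfold cosh, sinh; rewrite Ropp_plus_distr, !exp_plus; field.
Qed.

Lemma cosh_pos x : 0 < cosh x.
Proof.
  unfold cosh; pose proof (exp_pos x); pose proof (exp_pos (- x)); lra.
Qed.

Lemma Rabs_sinh_lt_cosh x : Rabs (sinh x) < cosh x.
Proof.
  unfold cosh, sinh; pose proof (exp_pos x); pose proof (exp_pos (- x)).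
  apply Rabs_def1; lra.
Qed.

(** The ratio of the two coefficients depends on [a - b] only. *)
Lemma edge_vector_shift (eps a b d : R) (u w : C) : eps ^ 2 = 1 ->
  (((eps * cosh b)%R, sinh a) * u)%C = (((eps * cosh a)%R, sinh b) * w)%C ->
  (((eps * cosh (b + d))%R, sinh (a + d)) * u)%C
  = (((eps * cosh (a + d))%R, sinh (b + d)) * w)%C.
Proof.
  intros Heps E.
  set (A := ((eps * cosh b)%R, sinh a) : C) in *.
  set (B := ((eps * cosh a)%R, sinh b) : C) in *.
  set (A' := ((eps * cosh (b + d))%R, sinh (a + d)) : C).
  set (B' := ((eps * cosh (a + d))%R, sinh (b + d)) : C).
  (* Equality of the ratios, cross-multiplied. In the real part the [sinh d] terms vanish because
     eps^2 = 1; in the imaginary part they agree because cosh^2 b + sinh^2 a = cosh^2 a + sinh^2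
     b. *)
  assert (HAB : (A * B')%C = (A' * B)%C).
  { unfold A, B, A', B'; rewrite !cosh_plus, !sinh_plus.
    pose proof (cosh2_sinh2 a) as Ha; pose proof (cosh2_sinh2 b) as Hb.
    apply injective_projections; simpl.
    - transitivity (cosh d * (eps ^ 2 * (cosh a * cosh b) - sinh a * sinh b)
        + sinh d * ((eps ^ 2 - 1) * (sinh a * cosh b))); [ring|].
      transitivity (cosh d * (eps ^ 2 * (cosh a * cosh b) - sinh a * sinh b)
        + sinh d * ((eps ^ 2 - 1) * (cosh a * sinh b))); [rewrite Heps|]; ring.
    - transitivity (eps * (cosh d * (cosh b * sinh b + sinh a * cosh a)
      + sinh d * (cosh b ^ 2 + sinh a ^ 2))); [ring|].
      transitivity (eps * (cosh d * (cosh b * sinh b + sinh a * cosh a)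
        + sinh d * (cosh a ^ 2 + sinh b ^ 2))); [rewrite Ha, Hb|]; ring. }
  assert (HB : B <> 0%C).
  { intros HB; apply (f_equal fst) in HB; simpl in HB.
    pose proof (cosh_pos a); nra. }
  transitivity (A' * B * u / B)%C; [now field|].
  rewrite <- HAB; transitivity (B' * (A * u) / B)%C; [now field|].
  rewrite E; now field.
Qed.

(** * From a ring pattern to a field of directions *)

Definition square_direction (P : Z * Z -> planar_ring) (s : Z * Z) : C :=
  let (m, n) := s in
  direction (center (P (m + 1, n)%Z)) (outer (P (m + 1, n)%Z))
            (center (P (m, n + 1)%Z)) (outer (P (m, n + 1)%Z)).

Lemma outer_pos (A : planar_ring) : 0 < outer A.
Proof.
  pose proof (inner_lt_outer A); pose proof (Rabs_pos (inner A)); lra.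
Qed.

(** The touching outer circles fix [u] and two centers. The other two follow because both inner
    circles are orthogonal at [p] to the outer circle of the ring at (m+1, n), which leaves the
    signs of [b] and [b'] undetermined. *)
Lemma pattern_square G P m n : orthogonal_ring_pattern G P -> G (m, n) ->
  let u := square_direction P (m, n) in
  dot u u = 1 /\
  exists (p : C) (b b' : R),
    touching_point P (m, n) p /\
    b ^ 2 = inner (P (m, n)) ^ 2 /\
    b' ^ 2 = inner (P (m + 1, n + 1)%Z) ^ 2 /\
    center (P (m, n)) = (p - b * (Ci * u))%C /\
    center (P (m + 1, n)%Z) = (p + outer (P (m + 1, n)%Z) * u)%C /\
    center (P (m + 1, n + 1)%Z) = (p + b' * (Ci * u))%C /\
    center (P (m, n + 1)%Z) = (p - outer (P (m, n + 1)%Z) * u)%C.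
Proof.
  intros HP HG u.
  destruct (orp_squares _ _ HP _ HG) as [p Hp].
  pose proof Hp as [Hin Hout].
  destruct (external_touching_point _ _ _ _ _ (outer_pos _) (outer_pos _) Hout)
    as [Hu [E10 E01]]; fold u in Hu, E10, E01.
  destruct Hin as [H00 [H11 _]], Hout as [[H10 _] _].
  destruct (inner_offset (P (m + 1, n)%Z) (P (m, n)) p u) as [b [E00 Hb]];
    try assumption.
  { apply (orp_neighbors _ _ HP), neighbor_sym, neighbor_h; now left. }
  destruct (inner_offset (P (m + 1, n)%Z) (P (m + 1, n + 1)%Z) p u)
    as [b' [E11 Hb']]; try assumption.
  { apply (orp_neighbors _ _ HP), neighbor_v; right.
    now replace (m + 1 - 1)%Z with m by ring. }
  (* The sign flip places the centers at (m, n) and (m+1, n+1) on opposite sides of [p] when the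
     offsets have equal sign. *)
  split; [exact Hu|exists p, b, (- b')].
  refine (conj Hp (conj Hb (conj _ (conj E00 (conj E10 (conj _ E01)))))).
  - rewrite <- Hb'; ring.
  - rewrite E11, RtoC_opp; ring.
Qed.

(** [s] and [t] are the two squares containing the edge [(v, w)], and [eps] is
    [1] on horizontal and [-1] on vertical edges. Both sides are the edge vector
    from [v] to [w], expressed in the frames of [s] and [t]. *)
Definition edge_compatible (eps : R) (rho : Z * Z -> R) (u : Z * Z -> C)
    (v w s t : Z * Z) : Prop :=
  0 < dot (u s) (u t) /\
  (((eps * cosh (rho w))%R, sinh (rho v)) * u s)%C
  = (((eps * cosh (rho v))%R, sinh (rho w)) * u t)%C.

(** The data of a pattern without its centers: conditions arise only on edges shared by two squares.
    The positive dot product in [edge_compatible] carries the order of the touching points. *)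
Record frame_field (G : quad_complex) (rho : Z * Z -> R) (u : Z * Z -> C)
  : Prop := {
  frame_unit : forall s, G s -> dot (u s) (u s) = 1;
  frame_h : forall m n, G (m, n) -> G (m, n - 1)%Z ->
    edge_compatible 1 rho u (m, n) (m + 1, n)%Z (m, n) (m, n - 1)%Z;
  frame_v : forall m n, G (m, n) -> G (m - 1, n)%Z ->
    edge_compatible (-1) rho u (m, n) (m, n + 1)%Z (m, n) (m - 1, n)%Z
}.

(** The directions are kept, so unit length and positive dot products persist; only the edge
    equation involves [rho]. *)
Lemma frame_field_shift G rho u delta :
  frame_field G rho u -> frame_field G (fun v => rho v + delta) u.
Proof.
  intros [Hu Hh Hv]; split; [exact Hu|intros m n H1 H2..].
  - destruct (Hh m n H1 H2) as [Hd E]; split; [exact Hd|].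
    apply edge_vector_shift; [ring|exact E].
  - destruct (Hv m n H1 H2) as [Hd E]; split; [exact Hd|].
    apply edge_vector_shift; [ring|exact E].
Qed.

(** The two squares at an edge give two expressions of the same edge vector, with offsets known up
    to sign. The turns of the touching points at both ends of the edge turn these offsets into the
    signed inner radii. *)
Lemma frame_field_of_pattern G P rho :
  orthogonal_ring_pattern G P ->
  (forall v, is_vertex G v -> is_rho_radius 1 (P v) (rho v)) ->
  frame_field G rho (square_direction P).
Proof.
  intros HP Hrho; split.
  - intros [m n] HG; now apply (pattern_square G P m n).
  - intros m n Hs Ht.
    destruct (pattern_square G P m n HP Hs)
      as [_ [q [b [c [Hq [Hb [_ [Ev [Ew _]]]]]]]]].
    destruct (pattern_square G P m (n - 1) HP Ht)
      as [Hu' [p [c' [b' [Hp [_ [Hb' [_ [_ [Ew' Ev']]]]]]]]]].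
    (* The counter-clockwise order passes from the lower to the upper square around the left end,
       and from the upper to the lower one around the right end. *)
    pose proof (orp_order _ _ HP _ _ _ _ _ (consecutive_right m n) Ht Hs Hp Hq)
      as [Hv1 Hv2].
    pose proof (consecutive_left (m + 1) n) as Hc.
    rewrite Z.add_simpl_r in Hc.
    pose proof (orp_order _ _ HP _ _ _ _ _ Hc Hs Ht Hq Hp) as [Hw1 Hw2].
    rewrite Z.sub_add in *.
    unfold edge_compatible.
    destruct (Hrho (m, n)) as [HRv Hrv]; [now left|].
    destruct (Hrho (m + 1, n)%Z) as [HRw Hrw].
    { simpl; rewrite Z.add_simpl_r; auto. }
    rewrite Rmult_1_l in HRv, Hrv, HRw, Hrw.
    rewrite <- HRv, <- Hrv, <- HRw, <- Hrw.
    set (us := square_direction P (m, n)) in *.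
    set (ut := square_direction P (m, n - 1)%Z) in *.
    assert (E : (((1 * outer (P (m + 1, n)%Z))%R, b) * us)%C
      = (((1 * outer (P (m, n)))%R, b') * ut)%C).
    { rewrite !Rmult_1_l.
      transitivity (center (P (m + 1, n)%Z) - center (P (m, n)))%C.
      - rewrite Ev, Ew; apply injective_projections; simpl; ring.
      - rewrite Ev', Ew'; apply injective_projections; simpl; ring. }
    (* Seen from an end of the edge, one touching point lies at distance the outer radius along the
       direction of its square, the other at the signed offset across its own; their determinant is
       the quantity that [edge_offsets] expects. *)
    assert (Dv : det (p - center (P (m, n))) (q - center (P (m, n)))
      = outer (P (m, n)) * b * dot us ut).
    { rewrite Ev' at 1; rewrite Ev; unfold det, dot; simpl; ring. }
    assert (Dw : det (q - center (P (m + 1, n)%Z)) (p - center (P (m + 1, n)%Z))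
      = outer (P (m + 1, n)%Z) * b' * dot us ut).
    { rewrite Ew at 1; rewrite Ew'; unfold det, dot; simpl; ring. }
    rewrite Dv in Hv1, Hv2; rewrite Dw in Hw1, Hw2.
    destruct (edge_offsets 1 (outer (P (m, n))) (inner (P (m, n)))
      (outer (P (m + 1, n)%Z)) (inner (P (m + 1, n)%Z)) b b' us ut)
      as [<- [<- Hd]]; auto using inner_lt_outer; ring.
  - intros m n Hs Ht.
    destruct (pattern_square G P m n HP Hs)
      as [_ [p [b [c [Hp [Hb [_ [Ev [_ [_ Ew]]]]]]]]]].
    destruct (pattern_square G P (m - 1) n HP Ht)
      as [Hu' [q [c' [b' [Hq [_ [Hb' [_ [Ev' [Ew' _]]]]]]]]]].
    pose proof (orp_order _ _ HP _ _ _ _ _ (consecutive_top m n) Hs Ht Hp Hq)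
      as [Hv1 Hv2].
    pose proof (consecutive_bottom m (n + 1)) as Hc.
    rewrite Z.add_simpl_r in Hc.
    pose proof (orp_order _ _ HP _ _ _ _ _ Hc Ht Hs Hq Hp) as [Hw1 Hw2].
    rewrite Z.sub_add in *.
    unfold edge_compatible.
    destruct (Hrho (m, n)) as [HRv Hrv]; [now left|].
    destruct (Hrho (m, n + 1)%Z) as [HRw Hrw].
    { simpl; rewrite Z.add_simpl_r; auto. }
    rewrite Rmult_1_l in HRv, Hrv, HRw, Hrw.
    rewrite <- HRv, <- Hrv, <- HRw, <- Hrw.
    set (us := square_direction P (m, n)) in *.
    set (ut := square_direction P (m - 1, n)%Z) in *.
    (* The sign -1 appears because the center at (m, n+1) lies at p - R u in the frame of the right
       square, whereas the center at (m+1, n) lies at p + R u. *)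
    assert (E : (((-1 * outer (P (m, n + 1)%Z))%R, b) * us)%C
      = (((-1 * outer (P (m, n)))%R, b') * ut)%C).
    { transitivity (center (P (m, n + 1)%Z) - center (P (m, n)))%C.
      - rewrite Ev, Ew; apply injective_projections; simpl; ring.
      - rewrite Ev', Ew'; apply injective_projections; simpl; ring. }
    assert (Dv : det (p - center (P (m, n))) (q - center (P (m, n)))
      = outer (P (m, n)) * b * dot us ut).
    { rewrite Ev at 1; rewrite Ev'; unfold det, dot; simpl; ring. }
    assert (Dw : det (q - center (P (m, n + 1)%Z)) (p - center (P (m, n + 1)%Z))
      = outer (P (m, n + 1)%Z) * b' * dot us ut).
    { rewrite Ew' at 1; rewrite Ew; unfold det, dot; simpl; ring. }
    rewrite Dv in Hv1, Hv2; rewrite Dw in Hw1, Hw2.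
    destruct (edge_offsets (-1) (outer (P (m, n))) (inner (P (m, n)))
      (outer (P (m, n + 1)%Z)) (inner (P (m, n + 1)%Z)) b b' us ut)
      as [<- [<- Hd]]; auto using inner_lt_outer; ring.
Qed.

(** * The edge vectors prescribed by a frame field *)

(** The upper square is read whenever it belongs to [G], the lower one otherwise; on a shared edge
    [frame_h] makes the two values equal. *)
Definition horizontal_form (G : quad_complex) rho u (v : Z * Z) : C :=
  let (m, n) := v in
  if excluded_middle_informative (G (m, n))
  then (((1 * cosh (rho (m + 1, n)%Z))%R, sinh (rho (m, n))) * u (m, n))%C
  else (((1 * cosh (rho (m, n)))%R, sinh (rho (m + 1, n)%Z))
        * u (m, n - 1)%Z)%C.

Definition vertical_form (G : quad_complex) rho u (v : Z * Z) : C :=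
  let (m, n) := v in
  if excluded_middle_informative (G (m, n))
  then (((-1 * cosh (rho (m, n + 1)%Z))%R, sinh (rho (m, n))) * u (m, n))%C
  else (((-1 * cosh (rho (m, n)))%R, sinh (rho (m, n + 1)%Z))
        * u (m - 1, n)%Z)%C.

(** The case distinction is on the coordinate difference because a proof of [neighbor] cannot be
    eliminated into [C]. The value 0 is a default for points that are not lattice neighbors. *)
Definition edge_form (G : quad_complex) rho u (v w : Z * Z) : C :=
  match (fst w - fst v, snd w - snd v)%Z with
  | (1, 0)%Z => horizontal_form G rho u v
  | (-1, 0)%Z => (- horizontal_form G rho u w)%C
  | (0, 1)%Z => vertical_form G rho u v
  | (0, -1)%Z => (- vertical_form G rho u w)%C
  | _ => 0%C
  end.

Lemma edge_form_h G rho u m n :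
  edge_form G rho u (m, n) (m + 1, n)%Z = horizontal_form G rho u (m, n).
Proof.
  unfold edge_form; cbn [fst snd].
  now replace (m + 1 - m)%Z with 1%Z by ring; rewrite Z.sub_diag.
Qed.

Lemma edge_form_v G rho u m n :
  edge_form G rho u (m, n) (m, n + 1)%Z = vertical_form G rho u (m, n).
Proof.
  unfold edge_form; cbn [fst snd].
  now replace (n + 1 - n)%Z with 1%Z by ring; rewrite Z.sub_diag.
Qed.

Lemma edge_form_h_opp G rho u m n :
  edge_form G rho u (m + 1, n)%Z (m, n) = (- horizontal_form G rho u (m, n))%C.
Proof.
  unfold edge_form; cbn [fst snd].
  now replace (m - (m + 1))%Z with (-1)%Z by ring; rewrite Z.sub_diag.
Qed.

Lemma edge_form_v_opp G rho u m n :
  edge_form G rho u (m, n + 1)%Z (m, n) = (- vertical_form G rho u (m, n))%C.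
Proof.
  unfold edge_form; cbn [fst snd].
  now replace (n - (n + 1))%Z with (-1)%Z by ring; rewrite Z.sub_diag.
Qed.

Lemma edge_form_anti G rho u v w : neighbor G v w ->
  edge_form G rho u w v = (- edge_form G rho u v w)%C.
Proof.
  induction 1 as [m n _|m n _|v w _ IH].
  - now rewrite edge_form_h, edge_form_h_opp.
  - now rewrite edge_form_v, edge_form_v_opp.
  - rewrite IH; ring.
Qed.

Lemma neighbor_vertices G v w : neighbor G v w -> is_vertex G v /\ is_vertex G w.
Proof.
  induction 1 as [m n H|m n H|v w _ IH]; [..|tauto];
    simpl; rewrite Z.add_simpl_r; tauto.
Qed.

(** * Realization of a frame field by rings *)

Section Realization.

Context (G : quad_complex) (rho : Z * Z -> R) (u : Z * Z -> C).
Hypothesis Hu : frame_field G rho u.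

Lemma horizontal_form_upper m n : G (m, n) ->
  horizontal_form G rho u (m, n)
  = (((1 * cosh (rho (m + 1, n)%Z))%R, sinh (rho (m, n))) * u (m, n))%C.
Proof.
  intros HG; unfold horizontal_form.
  now destruct (excluded_middle_informative (G (m, n))).
Qed.

Lemma horizontal_form_lower m n : G (m, n) ->
  horizontal_form G rho u (m, n + 1)%Z
  = (((1 * cosh (rho (m, n + 1)%Z))%R, sinh (rho (m + 1, n + 1)%Z))
     * u (m, n))%C.
Proof.
  intros HG; unfold horizontal_form.
  destruct (excluded_middle_informative (G (m, n + 1)%Z)) as [HG'|_].
  - rewrite (proj2 (frame_h _ _ _ Hu m (n + 1)%Z HG'
      ltac:(now rewrite Z.add_simpl_r))), Z.add_simpl_r; reflexivity.
  - now rewrite Z.add_simpl_r.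
Qed.

Lemma vertical_form_right m n : G (m, n) ->
  vertical_form G rho u (m, n)
  = (((-1 * cosh (rho (m, n + 1)%Z))%R, sinh (rho (m, n))) * u (m, n))%C.
Proof.
  intros HG; unfold vertical_form.
  now destruct (excluded_middle_informative (G (m, n))).
Qed.

Lemma vertical_form_left m n : G (m, n) ->
  vertical_form G rho u (m + 1, n)%Z
  = (((-1 * cosh (rho (m + 1, n)%Z))%R, sinh (rho (m + 1, n + 1)%Z))
     * u (m, n))%C.
Proof.
  intros HG; unfold vertical_form.
  destruct (excluded_middle_informative (G (m + 1, n)%Z)) as [HG'|_].
  - rewrite (proj2 (frame_v _ _ _ Hu (m + 1)%Z n HG'
      ltac:(now rewrite Z.add_simpl_r))), Z.add_simpl_r; reflexivity.
  - now rewrite Z.add_simpl_r.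
Qed.

(** In the frame of the square the four edge vectors have coefficients R10 + i r00, - R10 + i r11, -
    R01 - i r11 and R01 - i r00, which cancel. *)
Lemma edge_form_closed a b c d : square_face G a b c d ->
  (edge_form G rho u a b + edge_form G rho u b c + edge_form G rho u c d
   + edge_form G rho u d a = 0)%C.
Proof.
  destruct 1 as [m n HG].
  rewrite edge_form_h, edge_form_v, edge_form_h_opp, edge_form_v_opp.
  rewrite (horizontal_form_upper m n HG), (horizontal_form_lower m n HG),
    (vertical_form_right m n HG), (vertical_form_left m n HG).
  apply injective_projections; simpl; ring.
Qed.

Context (P : Z * Z -> planar_ring).
Hypothesis Hinner : forall v, inner (P v) = sinh (rho v).
Hypothesis Houter : forall v, outer (P v) = cosh (rho v).
Hypothesis Hcenter : forall v w, neighbor G v w ->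
  (center (P w) - center (P v))%C = edge_form G rho u v w.

Lemma framed_square m n : G (m, n) ->
  exists p : C,
    center (P (m, n)) = (p - sinh (rho (m, n)) * (Ci * u (m, n)))%C /\
    center (P (m + 1, n)%Z)
      = (p + cosh (rho (m + 1, n)%Z) * u (m, n))%C /\
    center (P (m + 1, n + 1)%Z)
      = (p + sinh (rho (m + 1, n + 1)%Z) * (Ci * u (m, n)))%C /\
    center (P (m, n + 1)%Z)
      = (p - cosh (rho (m, n + 1)%Z) * u (m, n))%C.
Proof.
  intros HG.
  assert (E1 := Hcenter (m, n) (m + 1, n)%Z (neighbor_h G _ _ (or_introl HG))).
  assert (E2 := Hcenter (m, n) (m, n + 1)%Z (neighbor_v G _ _ (or_introl HG))).
  assert (HG' : G (m, n + 1 - 1)%Z) by now rewrite Z.add_simpl_r.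
  assert (E3 := Hcenter (m, n + 1)%Z (m + 1, n + 1)%Z
    (neighbor_h G _ _ (or_intror HG'))).
  rewrite edge_form_h, horizontal_form_upper in E1 by exact HG.
  rewrite edge_form_v, vertical_form_right in E2 by exact HG.
  rewrite edge_form_h, horizontal_form_lower in E3 by exact HG.
  (* The candidate touching point is reached from one corner; three edges of the square then locate
     the other centers relative to it. *)
  exists (center (P (m, n)) + sinh (rho (m, n)) * (Ci * u (m, n)))%C.
  apply (f_equal (fun z => z + center (P (m, n)))%C) in E1, E2.
  apply (f_equal (fun z => z + center (P (m, n + 1)%Z))%C) in E3.
  replace (center (P (m + 1, n)%Z) - _ + _)%C
    with (center (P (m + 1, n)%Z)) in E1 by ring.
  replace (center (P (m, n + 1)%Z) - _ + _)%C
    with (center (P (m, n + 1)%Z)) in E2 by ring.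
  replace (center (P (m + 1, n + 1)%Z) - _ + _)%C
    with (center (P (m + 1, n + 1)%Z)) in E3 by ring.
  rewrite E3, E2, E1.
  repeat split; apply injective_projections; simpl; ring.
Qed.

(** The squared edge length is cosh^2 + sinh^2 of the two rho-radii, which equals 1 + sinh^2 +
    sinh^2 and is thus symmetric. So Pythagoras holds for both pairings of an outer with an inner
    circle. *)
Lemma framed_neighbors v w : neighbor G v w -> rings_orthogonal (P v) (P w).
Proof.
  assert (Hedge : forall eps v w s, eps ^ 2 = 1 -> G s ->
    (center (P w) - center (P v))%C
      = (((eps * cosh (rho w))%R, sinh (rho v)) * u s)%C \/
    (center (P w) - center (P v))%C
      = (((eps * cosh (rho v))%R, sinh (rho w)) * u s)%C ->
    rings_orthogonal (P v) (P w)).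
  { clear v w; intros eps v w s Heps Hs E.
    assert (Hd : dot (center (P w) - center (P v)) (center (P w) - center (P v))
      = 1 + sinh (rho v) ^ 2 + sinh (rho w) ^ 2).
    { destruct E as [E|E]; rewrite E.
      - transitivity ((eps ^ 2 * cosh (rho w) ^ 2 + sinh (rho v) ^ 2)
          * dot (u s) (u s)); [unfold dot; simpl; ring|].
        rewrite Heps, (frame_unit _ _ _ Hu _ Hs), cosh2_sinh2; ring.
      - transitivity ((eps ^ 2 * cosh (rho v) ^ 2 + sinh (rho w) ^ 2)
          * dot (u s) (u s)); [unfold dot; simpl; ring|].
        rewrite Heps, (frame_unit _ _ _ Hu _ Hs), cosh2_sinh2; ring. }
    pose proof (pow2_ge_0 (sinh (rho v))); pose proof (pow2_ge_0 (sinh (rho w))).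
    split; rewrite circles_orthogonal_iff; rewrite !Hinner, !Houter, !cosh2_sinh2;
      lra. }
  induction 1 as [m n H|m n H|v w _ IH].
  - pose proof (Hcenter _ _ (neighbor_h G m n H)) as E.
    rewrite edge_form_h in E; destruct H as [H|H].
    + rewrite horizontal_form_upper in E by exact H.
      apply (Hedge 1 _ _ (m, n)); [ring|auto..].
    + pose proof (horizontal_form_lower m (n - 1) H) as E'.
      rewrite Z.sub_add in E'; rewrite E' in E.
      apply (Hedge 1 _ _ (m, n - 1)%Z); [ring|auto..].
  - pose proof (Hcenter _ _ (neighbor_v G m n H)) as E.
    rewrite edge_form_v in E; destruct H as [H|H].
    + rewrite vertical_form_right in E by exact H.
      apply (Hedge (-1) _ _ (m, n)); [ring|auto..].
    + pose proof (vertical_form_left (m - 1) n H) as E'.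
      rewrite Z.sub_add in E'; rewrite E' in E.
      apply (Hedge (-1) _ _ (m - 1, n)%Z); [ring|auto..].
  - now apply rings_orthogonal_sym.
Qed.

Lemma framed_squares s : G s -> exists p, touching_point P s p.
Proof.
  destruct s as [m n]; intros HG.
  pose proof (frame_unit _ _ _ Hu _ HG) as Hun.
  destruct (framed_square m n HG) as [p [E00 [E10 [E11 E01]]]].
  exists p; unfold touching_point, circles_touch_externally_at, circles_touch_at.
  rewrite !on_circle_iff, !Hinner, !Houter, E00, E10, E11, E01.
  set (w := u (m, n)) in *.
  pose proof (Rmult_lt_0_compat _ _ (cosh_pos (rho (m + 1, n)%Z))
    (cosh_pos (rho (m, n + 1)%Z))) as Hpos.
  set (r00 := sinh (rho (m, n))); set (r11 := sinh (rho (m + 1, n + 1)%Z)).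
  set (R10 := cosh (rho (m + 1, n)%Z)) in *.
  set (R01 := cosh (rho (m, n + 1)%Z)) in *.
  repeat split.
  - transitivity (r00 ^ 2 * dot w w); [unfold dot; simpl; ring|].
    rewrite Hun; ring.
  - transitivity (r11 ^ 2 * dot w w); [unfold dot; simpl; ring|].
    rewrite Hun; ring.
  - unfold det; simpl; ring.
  - transitivity (R10 ^ 2 * dot w w); [unfold dot; simpl; ring|].
    rewrite Hun; ring.
  - transitivity (R01 ^ 2 * dot w w); [unfold dot; simpl; ring|].
    rewrite Hun; ring.
  - unfold det; simpl; ring.
  - match goal with |- ?x < 0 => replace x with (- (R10 * R01 * dot w w)) end.
    + rewrite Hun; lra.
    + unfold dot; simpl; ring.
Qed.

(** The order condition quantifies over all touching points. External tangency of the outer circles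
    determines the point, so it coincides with the one from [framed_square]. *)
Lemma framed_touching_point m n p : G (m, n) -> touching_point P (m, n) p ->
  (p - center (P (m, n)))%C = (sinh (rho (m, n)) * (Ci * u (m, n)))%C /\
  (p - center (P (m + 1, n)%Z))%C
    = (- cosh (rho (m + 1, n)%Z) * u (m, n))%C /\
  (p - center (P (m + 1, n + 1)%Z))%C
    = (- sinh (rho (m + 1, n + 1)%Z) * (Ci * u (m, n)))%C /\
  (p - center (P (m, n + 1)%Z))%C
    = (cosh (rho (m, n + 1)%Z) * u (m, n))%C.
Proof.
  intros HG [_ Hp].
  destruct (framed_square m n HG) as [q [E00 [E10 [E11 E01]]]].
  apply external_touching_point in Hp; try apply outer_pos.
  destruct Hp as [_ [Hp _]].
  assert (Hdir : direction (center (P (m + 1, n)%Z)) (outer (P (m + 1, n)%Z))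
    (center (P (m, n + 1)%Z)) (outer (P (m, n + 1)%Z)) = u (m, n)).
  { unfold direction; rewrite !Houter, E10, E01, RtoC_plus; field.
    rewrite <- RtoC_plus; intros H; apply RtoC_inj in H.
    pose proof (cosh_pos (rho (m + 1, n)%Z)).
    pose proof (cosh_pos (rho (m, n + 1)%Z)); lra. }
  assert (Hpq : p = q).
  { rewrite Hdir, E10, Houter in Hp.
    apply (f_equal (fun z => z - cosh (rho (m + 1, n)%Z) * u (m, n)))%C in Hp.
    ring_simplify in Hp; now symmetry. }
  rewrite Hpq, E00, E10, E11, E01; repeat split; ring.
Qed.

(** Around each vertex the determinant of consecutive touching points is cosh rho sinh rho times the
    positive dot product of the two directions, so it has the sign of the inner radius. *)
Lemma framed_order v s t p q :
  consecutive_squares v s t -> G s -> G t ->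
  touching_point P s p -> touching_point P t q ->
  turns_with_orientation (P v) p q.
Proof.
  assert (Hturn : forall v p q s t, 0 < dot (u s) (u t) ->
    det (p - center (P v)) (q - center (P v))
      = cosh (rho v) * sinh (rho v) * dot (u s) (u t) ->
    turns_with_orientation (P v) p q).
  { clear v s t p q; intros v p q s t Hd E; unfold turns_with_orientation.
    rewrite E, Hinner.
    pose proof (Rmult_lt_0_compat _ _ (cosh_pos (rho v)) Hd); split; nra. }
  intros Hc Hs Ht Hp Hq; destruct Hc as [m n|m n|m n|m n].
  - apply framed_touching_point in Hp, Hq; try assumption.
    destruct Hp as [_ [_ [_ Ep]]], Hq as [Eq _]; rewrite Z.sub_add in *.
    apply (Hturn _ _ _ (m, n) (m, n - 1)%Z).
    + apply (frame_h _ _ _ Hu m n Ht Hs).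
    + rewrite Ep, Eq; unfold det, dot; simpl; ring.
  - apply framed_touching_point in Hp, Hq; try assumption.
    destruct Hp as [Ep _], Hq as [_ [Eq _]]; rewrite Z.sub_add in *.
    apply (Hturn _ _ _ (m, n) (m - 1, n)%Z).
    + apply (frame_v _ _ _ Hu m n Hs Ht).
    + rewrite Ep, Eq; unfold det, dot; simpl; ring.
  - apply framed_touching_point in Hp, Hq; try assumption.
    destruct Hp as [_ [Ep _]], Hq as [_ [_ [Eq _]]]; rewrite !Z.sub_add in *.
    apply (Hturn _ _ _ (m - 1, n)%Z (m - 1, n - 1)%Z).
    + apply (frame_h _ _ _ Hu (m - 1)%Z n Hs Ht).
    + rewrite Ep, Eq; unfold det, dot; simpl; ring.
  - apply framed_touching_point in Hp, Hq; try assumption.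
    destruct Hp as [_ [_ [Ep _]]], Hq as [_ [_ [_ Eq]]]; rewrite !Z.sub_add in *.
    apply (Hturn _ _ _ (m, n - 1)%Z (m - 1, n - 1)%Z).
    + apply (frame_v _ _ _ Hu m (n - 1)%Z Ht Hs).
    + rewrite Ep, Eq; unfold det, dot; simpl; ring.
Qed.

Lemma framed_pattern : orthogonal_ring_pattern G P.
Proof.
  split; [exact framed_neighbors|exact framed_squares|exact framed_order].
Qed.

End Realization.

(** * Integration of the edge vectors and the one-parameter family *)

Lemma pattern_of_frame_field G rho u :
  complex_simply_connected G -> frame_field G rho u ->
  exists P, orthogonal_ring_pattern G P /\
    forall v, inner (P v) = sinh (rho v) /\ outer (P v) = cosh (rho v).
Proof.
  intros HG Hu.
  destruct (closed_form_exact (is_vertex G) (neighbor G) (square_face G)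
    (edge_form G rho u)) as [z Hz].
  - apply neighbor_vertices.
  - apply edge_form_anti.
  - exact (edge_form_closed G rho u Hu).
  - exact HG.
  (* The potential [z] supplies the centers; the radii are prescribed by [rho] at every lattice
     point. *)
  - exists (fun v => PlanarRing (z v) _ _ (Rabs_sinh_lt_cosh (rho v))).
    split; [|now split].
    now apply (framed_pattern G rho u Hu).
Qed.

Theorem corollary2p5 (G : quad_complex)
  (HG : complex_simply_connected G)
  (HGdual : dual_simply_connected G)
  (P : Z * Z -> planar_ring)
  (HP : orthogonal_ring_pattern G P)
  (Harea : forall v, is_vertex G v -> ring_area (P v) = PI)
  (rho : Z * Z -> R)
  (Hrho : forall v, is_vertex G v -> is_rho_radius 1 (P v) (rho v)) :
  exists Pd : R -> Z * Z -> planar_ring,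
    forall delta : R,
      orthogonal_ring_pattern G (Pd delta) /\
      (forall v, is_vertex G v ->
         is_rho_radius 1 (Pd delta v) (rho v + delta) /\
         inner (Pd delta v) = sinh (rho v + delta) /\
         outer (Pd delta v) = cosh (rho v + delta) /\
         ring_area (Pd delta v) = PI).
Proof.
  pose proof (frame_field_of_pattern G P rho HP Hrho) as Hu.
  (* The family must be given before [delta], so a pattern is chosen from the existence statement
     for each value of [delta]. *)
  exists (fun delta => proj1_sig (constructive_indefinite_description _
    (pattern_of_frame_field _ _ _ HG (frame_field_shift _ _ _ delta Hu)))).
  intros delta.
  destruct (constructive_indefinite_description _ _) as [Q [HQ Hradii]]; simpl.
  split; [exact HQ|intros v _].
  destruct (Hradii v) as [Hin Hout].
  unfold is_rho_radius, ring_area; rewrite Hin, Hout, cosh2_sinh2.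
  repeat split; ring.
Qed.
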